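(* For any pair of positive integers $i$ and $j$, the edge variant of subgraph reconfiguration under each of the TJ and TS rules can be solved in polynomial time for the property ''a graph is an $(i,j)$-biclique.''
   Context: Graphs are finite, simple and undirected. An $(i,j)$-biclique is a complete bipartite graph whose bipartition classes have $i$ and $j$ vertices. In the edge variant for property $\Pi$ on a graph $G$, a feasible solution is an edge subset $E'\subseteq E(G)$ such that the graph formed by $E'$ (edge set $E'$ together with all endpoints of its edges) satisfies $\Pi$. Under the token jumping (TJ) rule, two feasible solutions $X,Y$ are adjacent if $|X\setminus Y|=|Y\setminus X|=1$; under the token sliding (TS) rule, they are adjacent if additionally the edge in $X\setminus Y$ and the edge in $Y\setminus X$ share an endpoint. A reconfiguration sequence is a sequence of feasible solutions in which consecutive ones are adjacent. The problem: given $G$ and feasible source and target solutions $E_s,E_t$, decide whether a reconfiguration sequence from $E_s$ to $E_t$ exists. *)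

(* Defs.v *)
From mathcomp Require Import all_boot all_order all_algebra.

Set Implicit Arguments.
Unset Strict Implicit.
Unset Printing Implicit Defensive.

Import GRing.Theory.

(** * Polynomial time

  The model is the deterministic random-access machine with addition and
  truncated subtraction, given by structured programs: finitely many named
  registers (those occurring in the program) and an unbounded memory accessed
  through computed addresses.  Every operation has unit cost.  As there is no
  multiplication, the bit length of the numbers grows by at most one per
  operation, so polynomial time on this machine is polynomial time on Turing
  machines. *)

Inductive expr : Type :=
| Cst of nat
| Reg of nat
| Mem of expr
| Add of expr & expr
| Sub of expr & expr.

Inductive cmd : Type :=
| Skip
| Assign of nat & expr
| Store of expr & expr
| Seq of cmd & cmd
| If of expr & cmd & cmd
| While of expr & cmd.

Record state : Type := State { reg : nat -> nat; mem : nat -> nat }.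

Definition upd (f : nat -> nat) (k v : nat) : nat -> nat :=
  fun l => if l == k then v else f l.

Fixpoint eval (s : state) (e : expr) : nat :=
  match e with
  | Cst c => c
  | Reg x => reg s x
  | Mem a => mem s (eval s a)
  | Add a b => eval s a + eval s b
  | Sub a b => eval s a - eval s b
  end.

Fixpoint cost (e : expr) : nat :=
  match e with
  | Cst _ | Reg _ => 1
  | Mem a => (cost a).+1
  | Add a b | Sub a b => (cost a + cost b).+1
  end.

(** [exec c s t s']: started in [s], the program [c] halts in [s'] after
  exactly [t] elementary operations.  Nonzero values count as true. *)
Inductive exec : cmd -> state -> nat -> state -> Prop :=
| exec_skip s : exec Skip s 1 s
| exec_assign x e s :
    exec (Assign x e) s (cost e).+1 (State (upd (reg s) x (eval s e)) (mem s))
| exec_store a e s :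
    exec (Store a e) s (cost a + cost e).+1
         (State (reg s) (upd (mem s) (eval s a) (eval s e)))
| exec_seq c1 c2 s1 s2 s3 t1 t2 :
    exec c1 s1 t1 s2 -> exec c2 s2 t2 s3 -> exec (Seq c1 c2) s1 (t1 + t2) s3
| exec_if_true e c1 c2 s t s' :
    eval s e != 0 -> exec c1 s t s' -> exec (If e c1 c2) s (cost e + t).+1 s'
| exec_if_false e c1 c2 s t s' :
    eval s e = 0 -> exec c2 s t s' -> exec (If e c1 c2) s (cost e + t).+1 s'
| exec_while_done e c s :
    eval s e = 0 -> exec (While e c) s (cost e).+1 s
| exec_while_step e c s1 s2 s3 t1 t2 :
    eval s1 e != 0 -> exec c s1 t1 s2 -> exec (While e c) s2 t2 s3 ->
    exec (While e c) s1 (cost e + t1 + t2).+1 s3.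

(** The input string occupies the memory cells from address 0 on, its length
  is in register 0, and everything else is 0. *)
Definition init (w : seq bool) : state :=
  State (fun x => if x == 0 then size w else 0)
        (fun a => nat_of_bool (nth false w a)).

Definition accepts (s : state) : bool := reg s 0 != 0.

(** A decision problem is a type [I] of instances with their encoding as
  strings and the set of yes-instances; a program is only required to behave
  well on encodings of instances. *)
Definition poly_time_solvable (I : Type) (enc : I -> seq bool)
    (yes : I -> Prop) : Prop :=
  exists (c : cmd) (p : {poly nat}), forall x : I,
    exists (t : nat) (s : state),
      [/\ exec c (init (enc x)) t s,
          t <= p.[size (enc x)]%R
        & accepts s <-> yes x].

(** * Edge variant of subgraph reconfiguration *)

Record sgraph (T : finType) : Type := SGraph {
  edges : {set {set T}};
  edges_card2 : forall e, e \in edges -> #|e| = 2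
}.

(** A property of graphs given by a vertex set and an edge set, both over an
  ambient finite type of vertices. *)
Definition graph_property : Type :=
  forall T : finType, {set T} -> {set {set T}} -> bool.

Definition biclique (i j : nat) : graph_property := fun T V E =>
  [exists A : {set T}, exists B : {set T},
    [&& A :|: B == V, [disjoint A & B], #|A| == i, #|B| == j
      & E == [set [set a; b] | a in A, b in B]]].

(** The graph formed by [F] has as vertices the endpoints of the edges in [F],
  that is [cover F], so it has no isolated vertex. *)
Definition feasible (Pi : graph_property) (T : finType) (G : sgraph T)
    (F : {set {set T}}) : bool :=
  (F \subset edges G) && Pi T (cover F) F.

Inductive rule : Type := TJ | TS.

Definition adjacent (r : rule) (T : finType) (X Y : {set {set T}}) : bool :=
  [&& #|X :\: Y| == 1, #|Y :\: X| == 1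
    & match r with
      | TJ => true
      | TS => [exists e in X :\: Y, exists f in Y :\: X, e :&: f != set0]
      end].

Definition reconfigurable (Pi : graph_property) (r : rule) (T : finType)
    (G : sgraph T) (Es Et : {set {set T}}) : Prop :=
  exists p : seq {set {set T}},
    [/\ all (feasible Pi G) (Es :: p), path (@adjacent r T) Es p
      & last Es p = Et].

Record instance (Pi : graph_property) : Type := Instance {
  order : nat;
  graph : sgraph 'I_order;
  source : {set {set 'I_order}};
  target : {set {set 'I_order}};
  source_feasible : feasible Pi graph source;
  target_feasible : feasible Pi graph target
}.

Definition adjacency_bits (n : nat) (F : {set {set 'I_n}}) : seq bool :=
  [seq [set u; v] \in F | u <- enum 'I_n, v <- enum 'I_n].

(** The number of vertices in unary, a separator, and the row-major adjacency
  matrices of the graph and of the two solutions. *)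
Definition encode (Pi : graph_property) (x : instance Pi) : seq bool :=
  nseq (order x) true ++ false ::
  adjacency_bits (edges (graph x)) ++
  adjacency_bits (source x) ++ adjacency_bits (target x).

Definition edge_reconfiguration (Pi : graph_property) (r : rule)
    (x : instance Pi) : Prop :=
  reconfigurable Pi r (graph x) (source x) (target x).

(* Main.v *)
(** If both sides have at least two vertices, no two bicliques are adjacent, so
  the answer is yes iff source and target coincide.  Otherwise the bicliques are
  stars with [k] leaves, and stars with the same center can be transformed into
  each other leaf by leaf.  What remains is to see how the center can move:
  - not at all if [k >= 3], because adjacent stars then share two edges;
  - if [k = 2], from [a] to [b] iff there is a path [a b c] in [G], which under
    token sliding has to be part of a triangle;
  - if [k = 1], both ends of an edge are centers, so that the center moves along
    all edges; under token jumping the answer is always yes.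
  In every case the question becomes reachability in a graph on the vertices of
  [G] with locally testable adjacency, which a marking algorithm decides. *)

From mathcomp Require Import all_boot all_order all_algebra zify.
Require Import Defs.

Import GRing.Theory.

Set Implicit Arguments.
Unset Strict Implicit.
Unset Printing Implicit Defensive.

(** * Programs with time bounds *)

Definition terminates (c : cmd) (s : state) (B : nat) (Q : state -> Prop) :=
  exists t s', [/\ exec c s t s', t <= B & Q s'].

Lemma terminates_weaken c s B B' (Q Q' : state -> Prop) :
  terminates c s B Q -> B <= B' -> (forall s', Q s' -> Q' s') ->
  terminates c s B' Q'.
Proof.
by move=> [t [s' [? le_tB Qs']]] leB QQ'; exists t, s'; split;
  [|apply: leq_trans leB|apply: QQ'].
Qed.

Lemma terminates_assign x e s (Q : state -> Prop) :
  Q (State (upd (reg s) x (eval s e)) (mem s)) ->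
  terminates (Assign x e) s (cost e).+1 Q.
Proof. by move=> Qs; do 2!eexists; split; first exact: exec_assign. Qed.

Lemma terminates_seq c1 c2 s B1 B2 (Q1 Q2 : state -> Prop) :
  terminates c1 s B1 Q1 -> (forall s', Q1 s' -> terminates c2 s' B2 Q2) ->
  terminates (Seq c1 c2) s (B1 + B2) Q2.
Proof.
move=> [t1 [s1 [ex1 le1 /[swap] /[apply]]]] [t2 [s2 [ex2 le2 Qs2]]].
by exists (t1 + t2), s2; split; [exact: exec_seq ex2|exact: leq_add|].
Qed.

Lemma terminates_assign_seq x e c s B (Q : state -> Prop) :
  terminates c (State (upd (reg s) x (eval s e)) (mem s)) B Q ->
  terminates (Seq (Assign x e) c) s ((cost e).+1 + B) Q.
Proof.
move=> tc; apply: (@terminates_seq _ _ _ _ _ (eq _)) (terminates_assign _) _.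
  exact: erefl.
by move=> _ <-.
Qed.

Lemma terminates_while e c (Inv : nat -> state -> Prop) N B s :
  Inv 0 s ->
  (forall k s', k < N -> Inv k s' ->
     eval s' e != 0 /\ terminates c s' B (Inv k.+1)) ->
  (forall s', Inv N s' -> eval s' e = 0) ->
  terminates (While e c) s (N * (cost e + B).+1 + (cost e).+1) (Inv N).
Proof.
move=> Inv0 step stop.
suff H m k s' : k + m = N -> Inv k s' ->
    terminates (While e c) s' (m * (cost e + B).+1 + (cost e).+1) (Inv N).
  exact: (H N 0).
elim: m k s' => [|m IH] k s'.
  rewrite addn0 => -> InvN; exists (cost e).+1, s'; split=> //.
  exact/exec_while_done/stop.
move=> kmN Invk; have [|ne0 [t1 [s1 [ex1 le1 Inv1]]]] := step k s' _ Invk.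
  by lia.
have [|t2 [s2 [ex2 le2 Q2]]] := IH k.+1 s1 _ Inv1; first by lia.
exists (cost e + t1 + t2).+1, s2; split=> //; first exact: exec_while_step ex2.
by lia.
Qed.

(** [rho] lists the known contents of an initial segment of the registers. Higher registers stay
    unconstrained, so a nested loop may take the next two for its counters and drop them
    afterwards. *)
Definition agree (rho : seq nat) (r : nat -> nat) :=
  forall z, z < size rho -> r z = nth 0 rho z.

Lemma agree_upd rho r z v :
  size rho <= z -> agree rho r -> agree rho (upd r z v).
Proof.
move=> le_z ag y lt_y; rewrite /= /upd; case: eqP => [eq_yz|_]; last exact: ag.
by rewrite eq_yz ltnNge le_z in lt_y.
Qed.

Lemma agree_cat rho rho' r : agree (rho ++ rho') r -> agree rho r.
Proof.
by move=> ag z lt_z; rewrite ag ?nth_cat ?lt_z // size_cat ltn_addr.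
Qed.

Definition tick (x : nat) : cmd :=
  Seq (Assign x (Add (Reg x) (Cst 1))) (Assign x.+1 (Add (Reg x.+1) (Reg 1))).

(** Register [x] counts the rounds; register [x.+1] holds the count multiplied
  by register 1, which makes the rows of an adjacency matrix addressable
  without multiplication. *)
Definition for_loop (x bound : nat) (body : cmd) : cmd :=
  Seq (Assign x (Cst 0)) (Seq (Assign x.+1 (Cst 0))
    (While (Sub (Reg bound) (Reg x)) (Seq body (tick x)))).

(** * Counting loops that act on a set of marks *)

Section Marking.

Variable w : seq bool.

(** The memory consists of the input [w] followed by the characteristic vector
  of the set [M] of marked numbers. *)
Definition stores (M : seq nat) (s : state) :=
  forall a, mem s a = if a < size w then nth false w a : nat
                      else (a - size w \in M : nat).

Definition transforms (rho : seq nat) (c : cmd) (g : seq nat -> seq nat)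
    (B : nat) :=
  forall s M, agree rho (reg s) -> stores M s ->
    terminates c s B (fun s' => agree rho (reg s') /\ stores (g M) s').

Definition computes (rho : seq nat) (e : expr) (P : seq nat -> bool) :=
  forall s M, agree rho (reg s) -> stores M s -> (eval s e != 0) = P M.

Lemma transforms_seq rho c1 c2 g1 g2 B1 B2 :
  transforms rho c1 g1 B1 -> transforms rho c2 g2 B2 ->
  transforms rho (Seq c1 c2) (g2 \o g1) (B1 + B2).
Proof.
move=> t1 t2 s M ag st; apply: terminates_seq (t1 s M ag st) _ => s' [].
exact: t2.
Qed.

Definition mark (cond tgt : expr) : cmd :=
  If cond (Store (Add (Reg 0) tgt) (Cst 1)) Skip.

Lemma transforms_mark rho cond P tgt v :
  0 < size rho -> nth 0 rho 0 = size w -> computes rho cond P ->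
  (forall s, agree rho (reg s) -> eval s tgt = v) ->
  transforms rho (mark cond tgt) (fun M => if P M then v :: M else M)
    (cost cond + cost tgt + 5).
Proof.
move=> rho0 rho0E condP tgtE s M ag st; rewrite -(condP s M ag st).
case: (eqVneq (eval s cond) 0) => [e0|eN0].
  by do 2!eexists; split; [exact/exec_if_false/exec_skip | lia | split].
do 2!eexists; split; [exact/exec_if_true/exec_store | by rewrite /=; lia |].
split=> // a /=; rewrite /upd ag // rho0E tgtE // in_cons.
(* Input cells keep their bits, because the written address [size w + v] lies behind the input. *)
have := st a; case: ltnP => [lt_a|le_a] ->; first by rewrite ifN //; lia.
by case: eqP => [->|ne]; rewrite ?addKn ?eqxx //; case: eqP => //; lia.
Qed.

(** The time is stated with an upper bound [L] of the number of rounds, so that it can become a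
    polynomial in the input length. The final counters are kept in the postcondition because [N * n]
    is itself a useful result. *)
Lemma terminates_for rho bound body N n g B L s M :
  1 < size rho -> bound < size rho -> nth 0 rho bound = N -> nth 0 rho 1 = n ->
  N <= L ->
  (forall k, k < N -> transforms (rho ++ [:: k; k * n]) body (g k) B) ->
  agree rho (reg s) -> stores M s ->
  terminates (for_loop (size rho) bound body) s (L * (B + 20) + 20)
    (fun s' => agree (rho ++ [:: N; N * n]) (reg s') /\
               stores (foldl (fun M k => g k M) M (iota 0 N)) s').
Proof.
move=> lt1 ltb bN b1 le_NL tr ag st; set x := size rho.
pose Inv k s' := agree (rho ++ [:: k; k * n]) (reg s') /\
  stores (foldl (fun M k => g k M) M (iota 0 k)) s'.
have agE s' k : agree rho (reg s') -> reg s' x = k -> reg s' x.+1 = k * n ->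
    agree (rho ++ [:: k; k * n]) (reg s').
  move=> ag' rx rx1 z; rewrite size_cat nth_cat addn2 !ltnS leq_eqVlt.
  case: (ltnP z (size rho)) => [lt_z _|le_z]; first exact: ag'.
  case/orP=> [/eqP->|?]; first by rewrite subSnn.
  have -> : z = x by lia.
  by rewrite subnn.
have regE s' k : agree (rho ++ [:: k; k * n]) (reg s') ->
    [/\ reg s' x = k, reg s' x.+1 = k * n, reg s' bound = N & reg s' 1 = n].
  move=> ag'; have ltx m : m < 2 -> x + m < size (rho ++ [:: k; k * n]).
    by rewrite size_cat ltn_add2l.
  have := ag' _ (ltx 0 isT); have := ag' _ (ltx 1 isT).
  rewrite !nth_cat addn0 addn1 ltnn ltnNge leqnSn subnn subSnn /= => rx1 rx.
  by split; rewrite // (agree_cat ag').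
(* The loop test costs 3, [tick] costs 8, and the last, failing test costs 4. *)
pose B' := N * (3 + (B + 8)).+1 + 4.
apply: (@terminates_weaken _ _ (2 + (2 + B')) _ (Inv N)) => //; last first.
  by rewrite /B'; have := leq_mul le_NL (leqnn (B + 12)); lia.
do 2!apply: terminates_assign_seq; apply: terminates_while.
- split; last by move=> a /=; exact: st.
  apply: agE => //=.
  + by do 2!apply: agree_upd => //.
  + by rewrite /upd eqn_leq ltnn andbF eqxx.
  + by rewrite /upd eqxx.
- move=> k s' lt_kN [ag' st']; split=> /=.
    by have [-> _ -> _] := regE _ _ ag'; rewrite -lt0n subn_gt0.
  apply: terminates_seq (tr k lt_kN _ _ ag' st') _ => -[r m] [ag2 st2].
  have [/= rx rx1 _ r1] := regE _ _ ag2.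
  apply: (terminates_assign_seq (B := 4)); apply: terminates_assign => /=.
  split; last by rewrite -addn1 iotaD foldl_cat add0n.
  apply: agE => //=.
  + by do 2!apply: agree_upd => //; exact: agree_cat ag2.
  + by rewrite /upd eqn_leq ltnn andbF eqxx rx addn1.
  + rewrite /upd eqxx [x.+1 == x]eqn_leq ltnn rx1 /= ifN ?r1; last by lia.
    by rewrite mulSn addnC.
- by move=> s' [/regE[rx _ rb _] _] /=; rewrite rx rb subnn.
Qed.

Lemma transforms_for rho bound body N n g B L :
  1 < size rho -> bound < size rho -> nth 0 rho bound = N -> nth 0 rho 1 = n ->
  N <= L ->
  (forall k, k < N -> transforms (rho ++ [:: k; k * n]) body (g k) B) ->
  transforms rho (for_loop (size rho) bound body)
    (fun M => foldl (fun M k => g k M) M (iota 0 N)) (L * (B + 20) + 20).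
Proof.
move=> lt1 ltb bN b1 le_NL tr s M ag st.
apply: terminates_weaken (terminates_for lt1 ltb bN b1 le_NL tr ag st) _ _ => //.
by move=> s' [/agree_cat].
Qed.

(** Under truncated subtraction [1 - e] is the negation of [e], so this is De Morgan's law; the
    value is always 0 or 1. *)
Definition conj_expr (e1 e2 : expr) : expr :=
  Sub (Cst 1) (Add (Sub (Cst 1) e1) (Sub (Cst 1) e2)).

Lemma computes_conj rho e1 e2 P1 P2 :
  computes rho e1 P1 -> computes rho e2 P2 ->
  computes rho (conj_expr e1 e2) (fun M => P1 M && P2 M).
Proof.
by move=> c1 c2 s M ag st; rewrite -(c1 s M ag st) -(c2 s M ag st) /=; lia.
Qed.

(** One of the two truncated differences vanishes, so the sum is the distance of the two values. *)
Definition neq_expr (e1 e2 : expr) : expr := Add (Sub e1 e2) (Sub e2 e1).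

Lemma computes_marked rho e v :
  0 < size rho -> nth 0 rho 0 = size w ->
  (forall s, agree rho (reg s) -> eval s e = v) ->
  computes rho (Mem (Add (Reg 0) e)) (fun M => v \in M).
Proof.
move=> rho0 rho0E eE s M ag st /=.
by rewrite st ag // rho0E eE // ltnNge leq_addr addKn; case: (v \in M).
Qed.

End Marking.

(** * Reachability by marking *)

Lemma foldl_invariant (A : eqType) (X : Type) (P : X -> Prop) (f : X -> A -> X)
    (s : seq A) (x : X) :
  P x -> (forall y k, k \in s -> P y -> P (f y k)) -> P (foldl f x s).
Proof.
elim: s x => //= k s IH x Px Pf.
apply: IH; first by apply: Pf; rewrite ?mem_head.
by move=> y k' k's; apply: Pf; rewrite in_cons k's orbT.
Qed.

(** [P] survives until [k0] is processed, that step turns it into [Q], and [Q] survives the rest. *)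
Lemma foldl_reaches (A : eqType) (X : Type) (P Q : X -> Prop) (f : X -> A -> X)
    (s : seq A) (k0 : A) (x : X) :
  P x -> k0 \in s -> (forall y k, P y -> P (f y k)) ->
  (forall y k, Q y -> Q (f y k)) -> (forall y, P y -> Q (f y k0)) ->
  Q (foldl f x s).
Proof.
move=> Px + Pf Qf PQ; elim: s x Px => //= k s IH x Px.
rewrite in_cons => /orP[/eqP<-|/IH]; last by apply; exact: Pf.
by apply: foldl_invariant => [|y k' _]; [exact: PQ | exact: Qf].
Qed.

Section Sweep.

Variables (n : nat) (start step stop : nat -> nat -> nat -> bool).

(** The number [n], which is not a vertex, gets marked when a vertex satisfying
  [stop] has been reached. *)
Definition rules (a b c : nat) (M : seq nat) : seq nat :=
  let M1 := if start a b c then a :: M else M in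
  let M2 := if (a \in M1) && step a b c then b :: M1 else M1 in
  if (a \in M2) && stop a b c then n :: M2 else M2.

Definition sweep (M : seq nat) : seq nat :=
  foldl (fun M a => foldl (fun M b => foldl (fun M c =>
    rules a b c M) M (iota 0 n)) M (iota 0 n)) M (iota 0 n).

Definition step_rel : rel 'I_n :=
  [rel a b : 'I_n | [exists c : 'I_n, step a b c]].
Definition start_pred : pred 'I_n :=
  [pred a : 'I_n | [exists b : 'I_n, exists c : 'I_n, start a b c]].
Definition stop_pred : pred 'I_n :=
  [pred a : 'I_n | [exists b : 'I_n, exists c : 'I_n, stop a b c]].

Definition linked : bool :=
  [exists a, exists b, [&& start_pred a, connect step_rel a b & stop_pred b]].

Lemma rules_mono a b c v M : v \in M -> v \in rules a b c M.
Proof.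
by rewrite /rules => vM; do 3![case: ifP => _]; rewrite ?inE vM ?orbT.
Qed.

Lemma sweep_mono v M : v \in M -> v \in sweep M.
Proof.
move=> vM; do 3![apply: (foldl_invariant (P := fun M => v \in M)) => // ? ? _ ?].
exact: rules_mono.
Qed.

(** Every triple of vertices comes up during a sweep. [P] still holds when it is the turn of
    [(a, b, c)], and the mark set there is never removed. *)
Lemma sweep_reaches (a b c : 'I_n) (P : seq nat -> Prop) v M :
  P M -> (forall M a b c, P M -> P (rules a b c M)) ->
  (forall M, P M -> v \in rules a b c M) -> v \in sweep M.
Proof.
move=> PM Pr vr; pose Q (M : seq nat) : Prop := v \in M.
have Qr y a' b' c' : Q y -> Q (rules a' b' c' y) by exact: rules_mono.
have in_n (d : 'I_n) : val d \in iota 0 n by rewrite mem_iota ltn_ord.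
apply: (foldl_reaches (P := P) (Q := Q) PM (in_n a)) => [y k|y k|y Py].
- by move=> ?; do 2!apply: foldl_invariant => // ? ? _ ?; apply: Pr.
- by move=> ?; do 2!apply: foldl_invariant => // ? ? _ ?; apply: Qr.
apply: (foldl_reaches (P := P) (Q := Q) Py (in_n b)) => [z k|z k|z Pz].
- by move=> ?; apply: foldl_invariant => // ? ? _ ?; apply: Pr.
- by move=> ?; apply: foldl_invariant => // ? ? _ ?; apply: Qr.
apply: (foldl_reaches (P := P) (Q := Q) Pz (in_n c)) => [t k|t k|t Pt].
- exact: Pr.
- exact: Qr.
- exact: vr.
Qed.

(** The invariant behind one direction of [linkedP]: marks are only ever set for a good reason. *)
Definition sound (M : seq nat) : Prop :=
  (forall u : 'I_n, val u \in M ->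
     exists2 a, start_pred a & connect step_rel a u) /\ (n \in M -> linked).

Lemma sound_cons v M :
  sound M -> (forall u : 'I_n, val u = v ->
     exists2 a, start_pred a & connect step_rel a u) ->
  (v = n -> linked) -> sound (v :: M).
Proof.
move=> [sM nM] sv nv; split=> [u|]; rewrite in_cons => /orP[/eqP e|].
- exact: sv.
- exact: sM.
- exact: nv.
- exact: nM.
Qed.

Lemma sound_sweep M : sound M -> sound (sweep M).
Proof.
move=> sM.
apply: foldl_invariant => // Ma a; rewrite mem_iota add0n => /= lt_a Pa.
apply: foldl_invariant => // Mb b; rewrite mem_iota add0n => /= lt_b Pb.
apply: foldl_invariant => // Mc c; rewrite mem_iota add0n => /= lt_c {sM Pa Pb}.
pose oa := Ordinal lt_a; pose ob := Ordinal lt_b; pose oc := Ordinal lt_c.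
move=> Pc; rewrite /rules.
set M1 := if start a b c then _ else _.
have P1 : sound M1.
  rewrite /M1; case: ifP => // st; apply: sound_cons => // [u eu|e]; last first.
    by move: (lt_a); rewrite {1}e ltnn.
  exists u; last exact: connect0.
  by apply/existsP; exists ob; apply/existsP; exists oc; rewrite /= eu.
set M2 := if _ && step a b c then _ else _.
have P2 : sound M2.
  rewrite /M2; case: ifP => // /andP[aM1 st].
  apply: sound_cons => // [u eu|e]; last first.
    by move: (lt_b); rewrite {1}e ltnn.
  have [s ss cs] := P1.1 oa aM1; exists s => //.
  apply: connect_trans cs _; apply: connect1; apply/existsP; exists oc.
  by rewrite /= eu.
case: ifP => // /andP[aM2 st]; apply: sound_cons => // [u eu|_].
  by have := ltn_ord u; rewrite [X in X < _]eu ltnn.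
have [s ss cs] := P2.1 oa aM2; apply/existsP; exists s; apply/existsP; exists oa.
rewrite ss cs /=.
by apply/existsP; exists ob; apply/existsP; exists oc.
Qed.

(** For completeness, one sweep marks the start vertex, one further sweep per edge of a path is
    enough to advance along it, and a last one marks [n]. *)
Lemma linkedP m : n + 2 <= m -> (n \in iter m sweep [::]) = linked.
Proof.
move=> le_m; apply/idP/idP.
  suff [] : sound (iter m sweep [::]) by [].
  by elim: m {le_m} => [|m IH] //=; exact: sound_sweep.
move=> /existsP[a /existsP[b /and3P[sa /connectP[p pp lp] sb]]].
have mono v k l : k <= l -> v \in iter k sweep [::] -> v \in iter l sweep [::].
  by move=> /subnK<-; elim: (l - k) => //= d IH /IH; exact: sweep_mono.
have M1 : val a \in iter 1 sweep [::].
  have /existsP[b' /existsP[c' st]] := sa.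
  apply: (@sweep_reaches a b' c' xpredT) => // M _; rewrite /rules st.
  by do 2![case: ifP => _]; rewrite !inE eqxx ?orbT.
(* A path without repeated vertices has fewer than [n] edges, which bounds the number of sweeps. *)
move: lp; case: (shortenP pp) => q' pq' uq' _ lp.
have Mq k x q : val x \in iter k sweep [::] -> path step_rel x q ->
    val (last x q) \in iter (k + size q) sweep [::].
  elim: q k x => [|y q IH] k x /=; first by rewrite addn0.
  move=> xM /andP[/existsP[c st] /IH]; rewrite addnS -addSn; apply.
  rewrite iterS; apply: (@sweep_reaches x y c (fun M => val x \in M)) => // M.
    by move=> a' b' c'; exact: rules_mono.
  move=> xM'; rewrite /rules; set M' := if start _ _ _ then _ else _.
  have -> : val x \in M' by rewrite /M'; case: ifP; rewrite ?inE xM' ?orbT.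
  by rewrite st; case: ifP => _; rewrite !inE eqxx ?orbT.
have := Mq 1 a q' M1 pq'; rewrite -lp => bM.
have szq : size q' < n.
  have := max_card (ssrbool.mem (a :: q')).
  by rewrite card_ord (card_uniqP uq').
apply: (mono _ (1 + size q').+1); first by lia.
have /existsP[b' /existsP[c' st]] := sb.
rewrite iterS; apply: (@sweep_reaches b b' c' (fun M => val b \in M)) => // M.
  by move=> ? ? ?; exact: rules_mono.
move=> bM'; rewrite /rules st; set M2 := if _ && step _ _ _ then _ else _.
suff -> : val b \in M2 by rewrite mem_head.
rewrite /M2; set M1' := if start _ _ _ then _ else _.
have bM1 : val b \in M1' by rewrite /M1'; case: ifP; rewrite ?inE bM' ?orbT.
by case: ifP; rewrite ?inE bM1 ?orbT.
Qed.

End Sweep.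

(** * The marking program and its running time *)

Section Program.

Variables (start step stop : expr) (negated : bool).

Definition marked (x : expr) : expr := Mem (Add (Reg 0) x).

Definition rules_cmd : cmd :=
  Seq (mark start (Reg 6))
    (Seq (mark (conj_expr (marked (Reg 6)) step) (Reg 8))
       (mark (conj_expr (marked (Reg 6)) stop) (Reg 1))).

Definition sweep_cmd : cmd :=
  for_loop 6 1 (for_loop 8 1 (for_loop 10 1 rules_cmd)).

(** Register 1 receives the number [n] of vertices, register 3 its square; the
  three vertices under consideration are in the registers 6, 8 and 10.  There
  are at least [n + 2] input bits, so that one sweep per input bit suffices. *)
Definition link_program : cmd :=
  Seq (While (Mem (Reg 1)) (Assign 1 (Add (Reg 1) (Cst 1))))
    (Seq (for_loop 2 1 Skip)
       (Seq (for_loop 4 0 sweep_cmd)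
          (Assign 0 (if negated then Sub (Cst 1) (marked (Reg 1))
                     else marked (Reg 1))))).

(** ['X] stands for the input length, which bounds the number of rounds of each loop. The fourfold
    [loop] pays for the sweeps over triples, [loop 20%:P] for squaring [n], and the unary scan costs
    7 per round. *)
Definition link_time : {poly nat} :=
  let loop (q : {poly nat}) := ('X * (q + 20%:P) + 20%:P)%R in
  let body : nat := cost start + cost step + cost stop + 60 in
  (loop (loop (loop (loop body%:P))) + loop 20%:P + 'X * 7%:P + 20%:P)%R.

(** The list is the register contents inside the innermost loop: [p] and [pn] belong to the sweep
    counter, and each vertex is followed by its row offset. *)
Definition vertex_test (w : seq bool) (n : nat) (e : expr)
    (P : nat -> nat -> nat -> bool) : Prop :=
  forall p pn a b c cn, a < n -> b < n -> c < n ->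
  computes w [:: size w; n; n; n * n; p; pn; a; a * n; b; b * n; c; cn] e
    (fun=> P a b c).

Variables (w : seq bool) (n : nat) (S T F : nat -> nat -> nat -> bool).
Hypothesis size_w : n + 2 <= size w.
Hypothesis unary_w : forall k, k <= n -> nth false w k = (k < n).
Hypothesis startP : vertex_test w n start S.
Hypothesis stepP : vertex_test w n step T.
Hypothesis stopP : vertex_test w n stop F.

Let le_nw : n <= size w. Proof. by move: size_w; lia. Qed.

Lemma transforms_rules p pn a b c cn : a < n -> b < n -> c < n ->
  transforms w [:: size w; n; n; n * n; p; pn; a; a * n; b; b * n; c; cn]
    rules_cmd (rules n S T F a b c)
    (cost start + cost step + cost stop + 60).
Proof.
move=> lt_a lt_b lt_c; set rho := [:: size w, _ & _].
have markedP : computes w rho (marked (Reg 6)) (fun M => a \in M).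
  by apply: computes_marked => // s ag; rewrite /= ag.
have reg6 s : agree rho (reg s) -> eval s (Reg 6) = a.
  by move=> ag; rewrite /= ag.
have reg8 s : agree rho (reg s) -> eval s (Reg 8) = b.
  by move=> ag; rewrite /= ag.
have reg1 s : agree rho (reg s) -> eval s (Reg 1) = n.
  by move=> ag; rewrite /= ag.
have t1 := transforms_mark (rho := rho) isT erefl
  (@startP p pn a b c cn lt_a lt_b lt_c) reg6.
have t2 := transforms_mark (rho := rho) isT erefl
  (computes_conj markedP (@stepP p pn a b c cn lt_a lt_b lt_c)) reg8.
have t3 := transforms_mark (rho := rho) isT erefl
  (computes_conj markedP (@stopP p pn a b c cn lt_a lt_b lt_c)) reg1.
have t123 := transforms_seq t1 (transforms_seq t2 t3).
move=> s M ag st; apply: terminates_weaken (t123 s M ag st) _ _.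
  by rewrite /=; lia.
by move=> s' [].
Qed.

Lemma transforms_sweep p pn :
  let loop B := size w * (B + 20) + 20 in
  transforms w [:: size w; n; n; n * n; p; pn] sweep_cmd (sweep n S T F)
    (loop (loop (loop (cost start + cost step + cost stop + 60)))).
Proof.
move=> loop.
apply: (transforms_for (n := n) (N := n)) => // a lt_a.
apply: (transforms_for (n := n) (N := n)) => // b lt_b.
apply: (transforms_for (n := n) (N := n)) => // c lt_c.
exact: transforms_rules.
Qed.

Lemma link_program_correct :
  terminates link_program (init w) link_time.[size w]%R
    (fun s => accepts s = negated (+) linked n S T F).
Proof.
pose L := size w; pose loop B := L * (B + 20) + 20.
pose B := cost start + cost step + cost stop + 60.
have -> : (link_time.[size w])%R =
    loop (loop (loop (loop B))) + loop 20 + L * 7 + 20.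
  by rewrite /link_time !(hornerD, hornerM, hornerX, hornerC).
pose Inv k s := [/\ reg s 0 = L, reg s 1 = k & mem s = mem (init w)].
have ex1 : terminates (While (Mem (Reg 1)) (Assign 1 (Add (Reg 1) (Cst 1))))
    (init w) (n * 7 + 3) (Inv n).
  apply: (terminates_while (B := 4)) => // [k s lt_kn [r0 r1 m]|s [_ r1 m]].
    rewrite /= m r1 /= unary_w ?lt_kn // 1?ltnW //; split=> //.
    by apply: terminates_assign; split; rewrite //= r1 addn1.
  by rewrite /= m r1 /= unary_w // ltnn.
(* The loop with empty body is run for its second counter, which ends as [n * n] in register 3. *)
have ex2 s : Inv n s -> terminates (for_loop 2 1 Skip) s (loop 1) (fun s' =>
    agree [:: L; n; n; n * n] (reg s') /\ stores w [::] s').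
  move=> [r0 r1 m].
  have tskip k : k < n ->
      transforms w ([:: L; n] ++ [:: k; k * n]) Skip id 1.
    by move=> _ s' M ag st; do 2!eexists; split; first exact: exec_skip.
  have ag : agree [:: L; n] (reg s) by case=> [|[|]].
  have st : stores w [::] s.
    by move=> a; rewrite m /=; case: ltnP => // le_a; rewrite nth_default.
  have := terminates_for (rho := [:: L; n]) (bound := 1) isT isT erefl erefl
    le_nw tskip ag st.
  move/terminates_weaken; apply=> // s' [ag' st']; split=> //.
  by elim: (iota 0 n) st'.
have ex3 s : agree [:: L; n; n; n * n] (reg s) /\ stores w [::] s ->
    terminates (for_loop 4 0 sweep_cmd) s (loop (loop (loop (loop B))))
      (fun s' => agree [:: L; n; n; n * n] (reg s') /\
                 stores w (iter L (sweep n S T F) [::]) s').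
  move=> [ag st].
  have tsweep k (_ : k < L) := @transforms_sweep k (k * n).
  have := transforms_for (rho := [:: L; n; n; n * n]) (bound := 0) isT isT erefl
    erefl (leqnn L) tsweep ag st.
  move/terminates_weaken; apply=> // s' [ag' st']; split=> //.
  suff -> : iter L (sweep n S T F) [::] =
    foldl (fun M _ => sweep n S T F M) [::] (iota 0 L) by [].
  elim: (L) => // l IH.
  by rewrite iterS IH -[in RHS]addn1 iotaD foldl_cat.
have ex4 s : agree [:: L; n; n; n * n] (reg s) /\
      stores w (iter L (sweep n S T F) [::]) s ->
    terminates (Assign 0 (if negated then Sub (Cst 1) (marked (Reg 1))
                          else marked (Reg 1))) s 9
    (fun s' => accepts s' = negated (+) linked n S T F).
  move=> [ag st].
  have markE : eval s (marked (Reg 1)) = linked n S T F.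
    rewrite /= st (ag 0 isT) (ag 1 isT) ltnNge leq_addr addKn.
    by rewrite linkedP.
  apply: (terminates_weaken (terminates_assign
    (Q := fun s' => accepts s' = negated (+) linked n S T F) _)) => //.
    rewrite /accepts; move: markE.
    by case: negated => /=; case: linked => ->; exact: erefl.
  by case: negated.
have := terminates_seq ex1 (fun s i1 => terminates_seq (ex2 s i1)
  (fun s i2 => terminates_seq (ex3 s i2) ex4)).
move/terminates_weaken; apply=> //.
have := leq_mul le_nw (leqnn 7); rewrite -/L.
have : loop 1 <= loop 20 by rewrite leq_add2r leq_mul2l orbT.
by lia.
Qed.

End Program.

(** * Reconfiguration of bicliques *)

Lemma eq_set2 (T : finType) (x y a b : T) :
  ([set x; y] == [set a; b]) =
  (x == a) && (y == b) || (x == b) && (y == a).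
Proof.
apply/eqP/idP => [eq_xy|/orP[] /andP[/eqP-> /eqP->] //]; last by rewrite setUC.
have := set21 x y; have := set22 x y; have := set21 a b; have := set22 a b.
rewrite -{1 2}eq_xy {3 4}eq_xy !inE [b == x]eq_sym [b == y]eq_sym.
rewrite [a == x]eq_sym [a == y]eq_sym.
by do 4!case: (_ == _).
Qed.

Section Reconfiguration.

Variables (Pi : graph_property) (r : rule) (T : finType) (G : sgraph T).
Implicit Types X Y Z : {set {set T}}.

Lemma reconfigurable_refl X : feasible Pi G X -> reconfigurable Pi r G X X.
Proof. by exists [::]; split=> //=; rewrite andbT. Qed.

Lemma reconfigurable_trans X Y Z :
  reconfigurable Pi r G X Y -> reconfigurable Pi r G Y Z ->
  reconfigurable Pi r G X Z.
Proof.
move=> [p [/= /andP[fX fp] pp <-]] [q [/= /andP[_ fq] pq <-]].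
exists (p ++ q); split; last by rewrite last_cat.
  by rewrite /= all_cat fX fp.
by rewrite cat_path pp.
Qed.

Lemma reconfigurable_adjacent X Y :
  feasible Pi G X -> feasible Pi G Y -> adjacent r X Y ->
  reconfigurable Pi r G X Y.
Proof. by move=> fX fY aXY; exists [:: Y]; rewrite /= fX fY aXY. Qed.

(** Each solution is represented by its centers. *)
Lemma reconfigurable_connect (cen : {set {set T}} -> pred T) (R : rel T) :
  (forall X, feasible Pi G X -> exists a, cen X a) ->
  (forall X a b, feasible Pi G X -> cen X a -> cen X b -> connect R a b) ->
  (forall X Y, feasible Pi G X -> feasible Pi G Y -> adjacent r X Y ->
     exists a b, [/\ cen X a, cen Y b & connect R a b]) ->
  (forall X Y a, feasible Pi G X -> feasible Pi G Y -> cen X a -> cen Y a ->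
     reconfigurable Pi r G X Y) ->
  (forall X a b, feasible Pi G X -> cen X a -> R a b ->
     exists Y, [/\ feasible Pi G Y, cen Y b & reconfigurable Pi r G X Y]) ->
  forall X Y, feasible Pi G X -> feasible Pi G Y ->
    reconfigurable Pi r G X Y <->
    exists a b, [/\ cen X a, connect R a b & cen Y b].
Proof.
move=> has_cen cen_conn adj_conn same_cen cen_step X Y fX fY; split.
  case=> p [+ + lastp]; rewrite -{}lastp {fY}.
  elim: p X fX => [|Z p IH] X fX /=.
    have [a ca] := has_cen X fX.
    by exists a, a; rewrite ca connect0.
  move=> /and3P[_ fZ fp] /andP[aXZ pp].
  (* The center [a'] from the induction hypothesis and the center [z] from adjacency may be
     different centers of the same solution [Z]; [cen_conn] joins them. *)
  have [|a' [b [ca' ab cb]]] := IH Z fZ _ pp; first by rewrite /= fZ.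
  have [a [z [ca cz az]]] := adj_conn _ _ fX fZ aXZ.
  exists a, b; split=> //; apply: connect_trans az (connect_trans _ ab).
  exact: cen_conn cz ca'.
move=> [a [b [ca /connectP[p pp ->]]]] cb {b}.
elim: p X fX a ca pp cb => [|c p IH] X fX a ca /=.
  by move=> _; exact: same_cen.
move=> /andP[Rac pp] cb; have [Z [fZ cZ rXZ]] := cen_step _ _ _ fX ca Rac.
exact: reconfigurable_trans rXZ (IH _ fZ _ cZ pp cb).
Qed.

End Reconfiguration.

(** * Stars as bicliques with one side of size one *)

Section Stars.

Variable T : finType.
Implicit Types (a b c x y : T) (L : {set T}).

Definition star c L : {set {set T}} := [set [set c; l] | l in L].

Lemma set2_inj c : injective (fun l => [set c; l]).
Proof.
move=> x y /eqP; rewrite eq_set2 eqxx /=.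
by case/orP=> [/eqP|/andP[/eqP-> /eqP->]].
Qed.

Lemma mem_star c L x y :
  ([set x; y] \in star c L) = (x == c) && (y \in L) || (y == c) && (x \in L).
Proof.
apply/imsetP/orP => [[l lL /eqP]|[] /andP[/eqP-> ?]].
- rewrite eq_set2 => /orP[] /andP[/eqP-> /eqP->]; rewrite eqxx lL.
    by left.
  by right.
- by exists y.
- by exists x; rewrite // setUC.
Qed.

Lemma starD c L L' : star c L :\: star c L' = star c (L :\: L').
Proof.
apply/setP=> e; rewrite inE; apply/andP/imsetP => [[eNL' /imsetP[l lL eE]]|].
  exists l => //; rewrite inE lL andbT; apply: contraNN eNL'.
  by rewrite eE => ?; apply: imset_f.
move=> [l /setDP[lL lNL'] ->]; split; last exact: imset_f.
by apply: contra lNL' => /imsetP[l' l'L' /set2_inj->].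
Qed.

Lemma card_star c L : #|star c L| = #|L|.
Proof. by rewrite card_imset //; exact: set2_inj. Qed.

Lemma star1 c l : star c [set l] = [set [set c; l]].
Proof. exact: imset_set1. Qed.

(** Hence stars with different centers share at most one edge, the source of rigidity for three or
    more leaves. *)
Lemma star_common a b L L' e :
  a != b -> e \in star a L -> e \in star b L' -> e = [set a; b].
Proof.
move=> neq_ab /imsetP[l _ ->] /imsetP[l' _ /eqP].
rewrite eq_set2 (negPf neq_ab) /= => /andP[_ /eqP->] //.
Qed.

Lemma cover_star c L : L != set0 -> cover (star c L) = c |: L.
Proof.
move=> /set0Pn[l0 l0L]; apply/setP=> x; rewrite /cover.
apply/bigcupP/setU1P => [[_ /imsetP[l lL ->] /set2P[]->]|[->|xL]].
- by left.
- by right.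
- by exists [set c; l0]; [apply: imset_f | rewrite set21].
- by exists [set c; x]; [apply: imset_f | rewrite set22].
Qed.

(** The only vertex of the first side is the center. Since [k > 0], it lies on an edge and so
    belongs to [cover E]. *)
Lemma biclique_starP k (E : {set {set T}}) : 0 < k ->
  reflect (exists c L, [/\ c \notin L, #|L| = k & E = star c L])
          (biclique 1 k (cover E) E).
Proof.
move=> k_gt0; apply: (iffP existsP) => [[A /existsP[B /and5P[_ dAB]]]|].
  move=> /cards1P[c AE] /eqP cB /eqP ->; exists c, B.
  split=> //; first by move: dAB; rewrite AE disjoints1.
  apply/setP=> e; apply/imset2P/imsetP => [[x y]|[y yB ->]].
    by rewrite AE => /set1P-> yB ->; exists y.
  by exists c y; rewrite // AE set11.
move=> [c [L [cNL cL ->]]]; exists [set c]; apply/existsP; exists L.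
rewrite cover_star -?card_gt0 ?cL // setUC [L :|: _]setUC eqxx disjoints1 cNL.
rewrite cards1 !eqxx /=; apply/eqP/setP=> e.
apply/imsetP/imset2P => [[y yL ->]|[x y /set1P-> yL ->]]; last by exists y.
by exists c y; rewrite ?set11.
Qed.

End Stars.

Lemma biclique_sym (T : finType) i j (V : {set T}) E :
  biclique i j V E = biclique j i V E.
Proof.
suff imp i' j' : biclique i' j' V E -> biclique j' i' V E.
  by apply/idP/idP; exact: imp.
move=> /existsP[A /existsP[B /and5P[VE dAB cA cB /eqP->]]].
apply/existsP; exists B; apply/existsP; exists A.
rewrite setUC VE disjoint_sym dAB cA cB; apply/eqP/setP=> e.
by apply/imset2P/imset2P => -[x y xA yB ->]; exists y x; rewrite // setUC.
Qed.

Lemma biclique_order_gt0 (T : finType) i j (V : {set T}) E :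
  0 < i -> biclique i j V E -> 0 < #|T|.
Proof.
move=> i_gt0 /existsP[A /existsP[B /and5P[_ _ /eqP cA _ _]]].
by apply: leq_trans (max_card A); rewrite cA.
Qed.

(** Removing one edge from a biclique with both sides of size at least 2 leaves
  a path of length 3 between the endpoints of this edge, which therefore lie on
  different sides of every biclique containing the remaining edges. *)
Lemma biclique_rigid (r : rule) (T : finType) i j (V W : {set T}) X Y :
  1 < i -> 1 < j -> biclique i j V X -> biclique i j W Y -> ~~ adjacent r X Y.
Proof.
move=> i_gt1 j_gt1.
move=> /existsP[A /existsP[B /and5P[_ dAB /eqP cA /eqP cB /eqP XE]]].
move=> /existsP[C /existsP[D /and5P[_ dCD _ _ /eqP YE]]].
apply/negP => /and3P[/cards1P[e XY] _ _].
have /setDP[] : e \in X :\: Y by rewrite XY set11.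
rewrite {1}XE => /imset2P[a b aA bB eE]; rewrite {}eE in XY *.
have [a' a'A neq_a] : exists2 a', a' \in A & a' != a.
  have : 0 < #|A :\ a| by move: (cardsD1 a A); rewrite aA; lia.
  by rewrite card_gt0 => /set0Pn[x /setD1P[? ?]]; exists x.
have [b' b'B neq_b] : exists2 b', b' \in B & b' != b.
  have : 0 < #|B :\ b| by move: (cardsD1 b B); rewrite bB; lia.
  by rewrite card_gt0 => /set0Pn[x /setD1P[? ?]]; exists x.
have AB x y : x \in A -> y \in B -> x != y.
  by move=> xA yB; apply: contraL yB => /eqP <-; rewrite (disjointFr dAB).
(* Only the edge [[set a; b]] is lost from [X], so all other pairs across the two sides are in
   [Y]. *)
have inY x y : x \in A -> y \in B -> (x != a) || (y != b) -> [set x; y] \in Y.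
  move=> xA yB ne; apply/negPn/negP => nY.
  have : [set x; y] \in X :\: Y by rewrite inE nY XE; apply: imset2_f.
  rewrite XY inE eq_set2 (negPf (AB _ _ xA bB)) /= orbF.
  by case/andP=> xa yb; rewrite xa yb in ne.
have YP x y : ([set x; y] \in Y) =
    (x \in C) && (y \in D) || (y \in C) && (x \in D).
  rewrite YE; apply/imset2P/orP => [[u v uC vD /eqP]|[]/andP[? ?]].
  - rewrite eq_set2 => /orP[]/andP[/eqP-> /eqP->]; rewrite uC vD; first by left.
    by right.
  - by exists x y.
  - by exists y x; rewrite // setUC.
(* Along the path [b], [a'], [b'], [a] in [Y] the sides alternate, which would put [[set a; b]] into
   [Y]. What remains is a Boolean tautology in eight memberships. *)
have := inY _ _ a'A bB; have := inY _ _ a'A b'B; have := inY _ _ aA b'B.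
rewrite !YP neq_a neq_b ?orbT => /(_ isT) + /(_ isT) + /(_ isT).
have CD x : (x \in C) && (x \in D) = false.
  by apply/negP => /andP[xC]; rewrite (disjointFr dCD).
move: (CD a) (CD a') (CD b) (CD b').
by do 8!case: (_ \in _).
Qed.

Definition ends (T : finType) (E : {set {set T}}) (a b c : T) : bool :=
  [set a; b] \in E.

(** A local test for the center: in a star with at least two leaves no other vertex lies on two
    edges. *)
Definition forks (T : finType) (E : {set {set T}}) (a b c : T) : bool :=
  [&& [set a; b] \in E, [set a; c] \in E & b != c].

(** The star at [a] with leaves [b] and [z] becomes the star at [b] with leaves
  [a] and [c] by replacing the edge [az] with [bc]; under token sliding these
  two edges must meet, so that [z = c]. *)
Definition path2 (r : rule) (T : finType) (E : {set {set T}}) (a b c : T) :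
    bool :=
  [&& [set a; b] \in E, [set b; c] \in E, c != a
    & if r is TS then [set a; c] \in E else true].

Definition center (T : finType) (t : T -> T -> T -> bool) : pred T :=
  [pred a | [exists b, exists c, t a b c]].

Definition via (T : finType) (t : T -> T -> T -> bool) : rel T :=
  [rel a b | [exists c, t a b c]].

(** * Reconfiguration of stars, by number of leaves *)

Section StarReconfiguration.

Variables (T : finType) (G : sgraph T) (k : nat) (r : rule).
Hypothesis k_gt0 : 0 < k.
Implicit Types (a b c : T) (L : {set T}) (X Y : {set {set T}}).

Notation feas := (feasible (biclique 1 k) G).
Notation reconf := (reconfigurable (biclique 1 k) r G).

Lemma feasible_starP X :
  reflect (exists c L,
             [/\ c \notin L, #|L| = k, X = star c L & X \subset edges G])
          (feas X).
Proof.
apply: (iffP andP) => [[XG /biclique_starP[//|c [L [cL Lk XE]]]]|].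
  by exists c, L.
move=> [c [L [cL Lk XE XG]]]; split=> //; apply/biclique_starP => //.
by exists c, L.
Qed.

Lemma feasible_star c L :
  c \notin L -> #|L| = k -> star c L \subset edges G -> feas (star c L).
Proof. by move=> *; apply/feasible_starP; exists c, L. Qed.

Lemma edge_neq a b : [set a; b] \in edges G -> a != b.
Proof. by move=> /edges_card2; rewrite cards2; case: (a != b). Qed.

(** The exchanged edges meet in [c], so the condition of token sliding comes for free. *)
Lemma adjacent_star c L L' :
  #|L :\: L'| = 1 -> #|L' :\: L| = 1 -> adjacent r (star c L) (star c L').
Proof.
move=> LL' L'L; rewrite /adjacent !starD !card_star LL' L'L !eqxx /=.
have /eqP/cards1P[l ->] := LL'; have /eqP/cards1P[l' ->] := L'L.
rewrite !star1; case: r => //; apply/existsP; exists [set c; l].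
rewrite set11; apply/existsP; exists [set c; l']; rewrite set11.
by apply/set0Pn; exists c; rewrite inE !set21.
Qed.

(** Induction on the size of [L :\: L']: a leaf outside [L'] is exchanged for a missing leaf of
    [L'], using only edges of the two given stars. *)
Lemma reconfigurable_star c L L' :
  c \notin L -> c \notin L' -> #|L| = k -> #|L'| = k ->
  star c L \subset edges G -> star c L' \subset edges G ->
  reconf (star c L) (star c L').
Proof.
move=> + cL' + L'k + L'G; have [m] := ubnP #|L :\: L'|.
elim: m L => // m IH L; rewrite ltnS => le_m cL Lk LG.
have [LL'0|[l lLL']] := set_0Vmem (L :\: L').
  have -> : L = L'.
    by apply/eqP; rewrite eqEcard Lk L'k leqnn andbT -setD_eq0 LL'0.
  by apply: reconfigurable_refl; exact: feasible_star.
(* As [L] and [L'] have the same size, so do their two differences. *)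
have [l' l'L'L] : exists l', l' \in L' :\: L.
  apply/set0Pn; rewrite -card_gt0; have := cardsD L' L; have := cardsD L L'.
  rewrite setIC Lk L'k => eLL' ->; rewrite -eLL' card_gt0.
  by apply/set0Pn; exists l.
have /setDP[lL lNL'] := lLL'; have /setDP[l'L' l'NL] := l'L'L.
pose M := l' |: (L :\ l).
have neq_ll' : l != l' by apply: contraNneq l'NL => <-.
have l'NLl : l' \notin L :\ l by rewrite !inE (negPf l'NL) andbF.
have ML : M :\: L = [set l'].
  apply/setP=> x; rewrite !inE.
  case: (eqVneq x l') => [->|_]; first by rewrite l'NL.
  by case: (x \in L); rewrite ?andbF.
have LM : L :\: M = [set l].
  apply/setP=> x; rewrite !inE; case: (eqVneq x l) => [->|_].
    by rewrite lL (negPf neq_ll').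
  by rewrite /=; case: (x \in L); rewrite ?orbT ?andbF.
have cM : c \notin M.
  rewrite !inE (negPf cL) andbF orbF.
  by apply: contraNneq cL' => ->.
have Mk : #|M| = k by rewrite cardsU1 l'NLl -Lk (cardsD1 l L) lL.
have MG : star c M \subset edges G.
  apply/subsetP=> e /imsetP[x /setU1P[->|/setD1P[_ xL]] ->].
    by apply: (subsetP L'G); exact: imset_f.
  by apply: (subsetP LG); exact: imset_f.
apply: (reconfigurable_trans (Y := star c M)).
  apply: reconfigurable_adjacent; try exact: feasible_star.
  by apply: adjacent_star; rewrite ?LM ?ML cards1.
apply: IH => //; apply: leq_trans le_m; rewrite -ltnS.
rewrite [#|L :\: L'|](cardsD1 l) lLL' ltnS; apply/subset_leq_card/subsetP=> x.
rewrite !inE; case: (eqVneq x l') => [->|_]; first by rewrite l'L'.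
by case: (x != l); rewrite ?andbF.
Qed.

(** A single edge can be read as a star at either of its ends. *)
Lemma star_center1 c L a : k = 1 -> c \notin L -> #|L| = k ->
  center (ends (star c L)) a ->
  exists L', [/\ a \notin L', #|L'| = k & star c L = star a L'].
Proof.
move=> -> /[swap] /eqP/cards1P[l ->]; rewrite inE => neq_cl.
move=> /existsP[b /existsP[d]]; rewrite /ends mem_star !in_set1.
case/orP=> /andP[/eqP bl /eqP ac].
  by exists [set l]; rewrite cards1 !inE bl.
by exists [set c]; rewrite cards1 !inE ac eq_sym neq_cl !star1 setUC.
Qed.

Lemma star_center2 c L a : 1 < k -> c \notin L -> #|L| = k ->
  center (forks (star c L)) a = (a == c).
Proof.
move=> k_gt1 cL Lk; apply/existsP/eqP => [[b /existsP[d /and3P[]]]|->].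
  rewrite !mem_star; case: eqP => //= _ /andP[/eqP-> _] /andP[/eqP->].
  by rewrite eqxx.
have /card_gt1P[b [d [bL dL neq_bd]]] : 1 < #|L| by rewrite Lk.
exists b; apply/existsP; exists d.
by rewrite /forks !mem_star eqxx bL dL neq_bd.
Qed.

Lemma adjacent_cardI X Y : adjacent r X Y -> #|X :&: Y| = #|X|.-1.
Proof.
case/and3P=> /eqP XY _ _; have := cardsD X Y.
by have := subset_leq_card (subsetIl X Y); lia.
Qed.

(** Distinct one-edge solutions are a single jump apart, whereas a sliding edge reaches exactly the
    edges of its connected component. *)
Lemma reconfigurable_edge X Y : k = 1 -> feas X -> feas Y ->
  if r is TJ then reconf X Y
  else reconf X Y <->
    exists a b, [/\ center (ends X) a, connect (via (ends (edges G))) a b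
                  & center (ends Y) b].
Proof.
move=> k1 fX fY.
have edgeP Z : feas Z -> exists a b, Z = [set [set a; b]].
  move=> /feasible_starP[a [L [_ + -> _]]]; rewrite k1 => /eqP/cards1P[b ->].
  by exists a, b; rewrite star1.
have centerP a b c : center (ends [set [set a; b]]) c = (c == a) || (c == b).
  apply/existsP/orP => [[d /existsP[d']]|[/eqP->|/eqP->]].
  - by rewrite /ends inE eq_set2 => /orP[]/andP[->]; [left|right].
  - by exists b; apply/existsP; exists b; rewrite /ends inE.
  - by exists a; apply/existsP; exists a; rewrite /ends inE setUC.
have inG Z a b : feas Z -> Z = [set [set a; b]] -> [set a; b] \in edges G.
  by case/andP=> /subsetP ZG _ ZE; apply: ZG; rewrite ZE set11.
have viaP a b : [set a; b] \in edges G -> connect (via (ends (edges G))) a b.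
  by move=> abG; apply: connect1; apply/existsP; exists a.
have edge_feas a b : [set a; b] \in edges G -> feas [set [set a; b]].
  move=> abG; rewrite -star1; apply: feasible_star; rewrite ?cards1 ?k1 //.
    by rewrite inE (edge_neq abG).
  by rewrite star1 sub1set.
have [a [b XE]] := edgeP X fX; have [c [d YE]] := edgeP Y fY.
have XY_neq : X != Y -> X :\: Y = X /\ Y :\: X = Y.
  rewrite XE YE => neq; have {}neq : [set a; b] != [set c; d].
    by apply: contraNneq neq => ->.
  by split; apply/setDidPl; rewrite disjoints1 inE // eq_sym.
case rE: r.
  have [<-|/XY_neq[XY YX]] := eqVneq X Y; first exact: reconfigurable_refl.
  apply: reconfigurable_adjacent => //.
  by rewrite /adjacent XY YX XE YE !cards1.
rewrite -rE; apply: (reconfigurable_connect (cen := fun X => center (ends X)))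
  => // {X Y fX fY a b c d XE YE XY_neq}.
- move=> X /edgeP[a [b XE]]; exists a; by rewrite XE centerP eqxx.
- move=> X a b fX; have [c [d XE]] := edgeP X fX; have cdG := inG _ _ _ fX XE.
  have dcG : [set d; c] \in edges G by rewrite setUC.
  rewrite XE !centerP => /orP[]/eqP-> /orP[]/eqP->; rewrite ?connect0 //.
    exact: viaP.
  exact: viaP.
- move=> X Y fX fY /and3P[XY YX]; rewrite rE => /existsP[e /andP[/setDP[eX _]]].
  move=> /existsP[f /andP[/setDP[fY' _]]] /set0Pn[x /setIP[xe xf]].
  have [a [b XE]] := edgeP X fX; have [c [d YE]] := edgeP Y fY.
  (* The common endpoint [x] of the two edges is a center of both solutions. *)
  exists x, x; rewrite XE YE !centerP connect0; move: xe xf eX fY'.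
  by rewrite XE YE => xe xf /set1P eE /set1P fE; rewrite eE fE !inE in xe xf.
- move=> X Y a /feasible_starP[c [L [cL Lk XE XG]]].
  move=> /feasible_starP[d [M [dM Mk YE YG]]].
  rewrite XE YE => /(star_center1 k1 cL Lk)[L' [aL' L'k LE]].
  move=> /(star_center1 k1 dM Mk)[M' [aM' M'k ME]].
  by rewrite LE ME; apply: reconfigurable_star; rewrite // -?LE -?ME -?XE -?YE.
- move=> X a b fX; have /feasible_starP[c [L [cL Lk XE XG]]] := fX.
  rewrite {1}XE => /(star_center1 k1 cL Lk)[L' [aL' L'k LE]] /existsP[d abG].
  exists [set [set a; b]]; split; first exact: edge_feas.
    by rewrite centerP eqxx orbT.
  rewrite XE LE -star1; apply: reconfigurable_star; rewrite ?cards1 //.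
  + by rewrite inE (edge_neq abG).
  + by rewrite -LE -XE.
  + by rewrite star1 sub1set.
Qed.

(** Adjacent solutions share [k - 1 >= 2] edges and hence the center, so reachability is taken in
    the empty relation, where it is equality. *)
Lemma reconfigurable_rigid_center X Y : 2 < k -> feas X -> feas Y ->
  reconf X Y <->
  exists a b, [/\ center (forks X) a, connect (via (fun _ _ _ : T => false)) a b
                & center (forks Y) b].
Proof.
move=> k_gt2; have k_gt1 := ltnW k_gt2.
move: X Y; apply: (reconfigurable_connect (cen := fun X => center (forks X))).
- move=> X' /feasible_starP[c [L [cL Lk -> _]]]; exists c.
  by rewrite (star_center2 _ k_gt1 cL Lk).
- move=> X' a b /feasible_starP[c [L [cL Lk -> _]]].
  by rewrite !(star_center2 _ k_gt1 cL Lk) => /eqP-> /eqP->; exact: connect0.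
- move=> X' Y' /feasible_starP[a [L [aL Lk XE _]]].
  move=> /feasible_starP[b [M [bM Mk YE _]]] /adjacent_cardI XY.
  have : 1 < #|X' :&: Y'| by rewrite XY XE card_star Lk; lia.
  case/card_gt1P=> e [f [/setIP[eX eY] /setIP[fX fY] neq_ef]].
  exists a, b; rewrite XE YE (star_center2 _ k_gt1 aL Lk) eqxx.
  rewrite (star_center2 _ k_gt1 bM Mk) eqxx; split=> //.
  suff -> : a = b by exact: connect0.
  apply: contraNeq neq_ef => neq_ab; rewrite XE YE in eX eY fX fY.
  by rewrite (star_common neq_ab eX eY) (star_common neq_ab fX fY).
- move=> X' Y' a /feasible_starP[c [L [cL Lk -> XG]]].
  move=> /feasible_starP[d [M [dM Mk -> YG]]].
  rewrite (star_center2 _ k_gt1 cL Lk) (star_center2 _ k_gt1 dM Mk).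
  move=> /eqP ac /eqP ad; rewrite -ac -ad in cL dM XG YG *.
  exact: reconfigurable_star.
- by move=> X' a b _ _ /existsP[].
Qed.

Lemma reconfigurable_path2 X Y : k = 2 -> feas X -> feas Y ->
  reconf X Y <->
  exists a b, [/\ center (forks X) a, connect (via (path2 r (edges G))) a b
                & center (forks Y) b].
Proof.
move=> k2; have k_gt1 : 1 < k by rewrite k2.
have pair_feas a b c : [set a; b] \in edges G -> [set a; c] \in edges G ->
    b != c -> [/\ a \notin [set b; c], #|[set b; c]| = k,
                  star a [set b; c] \subset edges G & feas (star a [set b; c])].
  move=> abG acG neq_bc.
  have aN : a \notin [set b; c] by rewrite !inE negb_or !edge_neq.
  have ck : #|[set b; c]| = k by rewrite cards2 neq_bc.
  have sG : star a [set b; c] \subset edges G.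
    by apply/subsetP=> e /imsetP[x /set2P[]-> ->].
  by split=> //; exact: feasible_star.
move: X Y; apply: (reconfigurable_connect (cen := fun X => center (forks X))).
- move=> X' /feasible_starP[c [L [cL Lk -> _]]]; exists c.
  by rewrite (star_center2 _ k_gt1 cL Lk).
- move=> X' a b /feasible_starP[c [L [cL Lk -> _]]].
  by rewrite !(star_center2 _ k_gt1 cL Lk) => /eqP-> /eqP->; exact: connect0.
- move=> X' Y' /feasible_starP[a [L [aL Lk XE XG]]].
  move=> /feasible_starP[b [M [bM Mk YE YG]]] adjXY.
  exists a, b; rewrite {1}XE {1}YE (star_center2 _ k_gt1 aL Lk) eqxx.
  rewrite (star_center2 _ k_gt1 bM Mk) eqxx; split=> //.
  have [->|neq_ab] := eqVneq a b; first exact: connect0.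
  (* Adjacent solutions share [k - 1 = 1] edge, and by [star_common] it joins the two centers. *)
  have [e eXY] : exists e, e \in X' :&: Y'.
    apply/set0Pn; rewrite -card_gt0 (adjacent_cardI adjXY) XE card_star Lk.
    by rewrite k2.
  have /setIP[eX eY] := eXY.
  have eE : e = [set a; b].
    by apply: (star_common (L := L) (L' := M)); rewrite -?XE -?YE.
  rewrite {}eE {e eXY} in eX eY.
  have [e [f [eXY fYX ef]]] : exists e f, [/\ e \in X' :\: Y', f \in Y' :\: X'
      & if r is TS then e :&: f != set0 else true].
    case/and3P: adjXY; case: (r) => /cards1P[e XY] /cards1P[f YX].
      by move=> _; exists e, f; rewrite XY YX !set11.
    by move=> /existsP[e' /andP[eX' /existsP[f' /andP[fY' ef]]]]; exists e', f'.
  have /setDP[eX' eNY] := eXY; have /setDP[fY' fNX] := fYX.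
  have /imsetP[l lL eE] : e \in star a L by rewrite -XE.
  have /imsetP[c cM fE] : f \in star b M by rewrite -YE.
  apply: connect1; apply/existsP; exists c; apply/and4P; split.
  + exact: subsetP XG _ eX.
  + by rewrite -fE; exact: subsetP YG _ fY'.
  + by apply: contraNneq fNX => ca; rewrite fE ca setUC.
  (* Under token sliding the exchanged edges [[set a; l]] and [[set b; c]] meet. Of the four
     coincidences only [l = c] is possible, which makes [[set a; c]] an edge of [G]. *)
  case: (r) ef => // /set0Pn[x /setIP[]].
  have bl : l != b by apply: contraNneq eNY => lb; rewrite eE lb.
  rewrite eE fE => /set2P[->|->] /set2P[] e2.
  + by rewrite e2 eqxx in neq_ab.
  + by rewrite fE -e2 setUC eX in fNX.
  + by rewrite e2 eqxx in bl.
  + by rewrite -e2 -eE; exact: subsetP XG _ eX'.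
- move=> X' Y' a /feasible_starP[c [L [cL Lk -> XG]]].
  move=> /feasible_starP[d [M [dM Mk -> YG]]].
  rewrite (star_center2 _ k_gt1 cL Lk) (star_center2 _ k_gt1 dM Mk).
  move=> /eqP ac /eqP ad; rewrite -ac -ad in cL dM XG YG *.
  exact: reconfigurable_star.
- move=> X' a b /feasible_starP[a' [L [aL Lk -> XG]]].
  rewrite (star_center2 _ k_gt1 aL Lk) => /eqP aa; rewrite -{a'}aa in aL XG *.
  case/existsP=> c /and4P[abG bcG neq_ca acG].
  have baG : [set b; a] \in edges G by rewrite setUC.
  have neq_ab := edge_neq abG; have neq_bc := edge_neq bcG.
  (* Under token jumping [z] is a leaf of the current star other than [b]; under token sliding it
     has to be [c]. *)
  have [z [azG neq_bz zc]] : exists z, [/\ [set a; z] \in edges G, b != z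
      & if r is TS then z = c else True].
    case: (r) acG => [_|]; last by exists c.
    have [z zL neq_zb] : exists2 z, z \in L & z != b.
      have : 0 < #|L :\ b| by move: (cardsD1 b L); rewrite Lk k2; lia.
      by rewrite card_gt0 => /set0Pn[x /setD1P[? ?]]; exists x.
    exists z; split; rewrite // 1?eq_sym //.
    by apply: (subsetP XG); exact: imset_f.
  have [aN ck sG fZ] := pair_feas _ _ _ abG azG neq_bz.
  have neq_ac : a != c by rewrite eq_sym.
  have [bN ck' sG' fY] := pair_feas _ _ _ baG bcG neq_ac.
  exists (star b [set a; c]); split=> //.
    by rewrite (star_center2 _ k_gt1 bN ck').
  (* First the leaves become [b] and [z] with the center [a] fixed; then [[set a; z]] is exchanged
     for [[set b; c]]. *)
  apply: (reconfigurable_trans (reconfigurable_star aL aN Lk ck XG sG)).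
  apply: reconfigurable_adjacent => //.
  have azN : [set a; z] \notin star b [set a; c].
    by rewrite mem_star (negPf neq_ab) [z == b]eq_sym (negPf neq_bz).
  have bcN : [set b; c] \notin star a [set b; z].
    by rewrite mem_star [b == a]eq_sym (negPf neq_ab) (negPf neq_ca).
  have ZY : star a [set b; z] :\: star b [set a; c] = [set [set a; z]].
    apply/setP=> e; rewrite in_setD in_set1; apply/andP/eqP => [[eN]|->].
      case/imsetP=> x /set2P[]-> eE //.
      by rewrite eE mem_star set21 eqxx orbT in eN.
    by rewrite azN; split=> //; apply: imset_f; rewrite set22.
  have YZ : star b [set a; c] :\: star a [set b; z] = [set [set b; c]].
    apply/setP=> e; rewrite in_setD in_set1; apply/andP/eqP => [[eN]|->].
      case/imsetP=> x /set2P[]-> eE //.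
      by rewrite eE mem_star set21 eqxx orbT in eN.
    by rewrite bcN; split=> //; apply: imset_f; rewrite set22.
  rewrite /adjacent ZY YZ !cards1 !eqxx /=; case: (r) zc => // ->.
  apply/existsP; exists [set a; c]; rewrite set11; apply/existsP.
  exists [set b; c]; rewrite set11.
  by apply/set0Pn; exists c; rewrite inE !set22.
Qed.

End StarReconfiguration.

(** * Reading the encoded instance *)

Lemma nth_allpairs (S T R : Type) (f : S -> T -> R) x0 y0 z0 s t i j :
  i < size s -> j < size t ->
  nth z0 [seq f x y | x <- s, y <- t] (i * size t + j) =
  f (nth x0 s i) (nth y0 t j).
Proof.
elim: s i => //= x s IH [|i] lt_i lt_j; rewrite nth_cat size_map.
  by rewrite lt_j (nth_map y0).
by rewrite mulSn -addnA ltnNge leq_addr /= addKn IH.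
Qed.

Section Encoding.

Variables (Pi : graph_property) (x : instance Pi).
Let n := order x.

Definition layer (k : nat) : {set {set 'I_n}} :=
  nth set0 [:: edges (graph x); source x; target x] k.

(** The summand [n.+1] skips the unary prefix and the separator, and [k * (n * n)] the preceding
    matrices. *)
Definition adjacency_bit (k u v : nat) : bool :=
  nth false (encode x) (k * (n * n) + n.+1 + (u * n + v)).

Lemma size_adjacency_bits (F : {set {set 'I_n}}) :
  size (adjacency_bits F) = n * n.
Proof. by rewrite size_allpairs !size_enum_ord. Qed.

Lemma size_encode : size (encode x) = n.+1 + 3 * (n * n).
Proof.
by rewrite size_cat size_nseq /= !size_cat !size_adjacency_bits -/n; lia.
Qed.

Lemma nth_encode_unary k : k <= n -> nth false (encode x) k = (k < n).
Proof.
move=> le_kn; rewrite nth_cat size_nseq -/n; case: ltnP => [lt_kn|le_nk].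
  by rewrite nth_nseq lt_kn.
have /eqP -> : k == n by rewrite eqn_leq le_kn.
by rewrite subnn.
Qed.

Lemma offset_lt u v : u < n -> v < n -> u * n + v < n * n.
Proof.
move=> lt_u lt_v; apply: leq_trans (_ : u.+1 * n <= _).
  by rewrite mulSn addnC ltn_add2r.
by rewrite leq_mul2r lt_u orbT.
Qed.

Lemma adjacency_bitE k (u v : 'I_n) :
  k < 3 -> adjacency_bit k u v = ([set u; v] \in layer k).
Proof.
move=> lt_k; have lt_uv := offset_lt (ltn_ord u) (ltn_ord v).
have bitsE (F : {set {set 'I_n}}) :
    nth false (adjacency_bits F) (u * n + v) = ([set u; v] \in F).
  have := @nth_allpairs _ _ _ (fun a b : 'I_n => [set a; b] \in F) u v false
    (enum 'I_n) (enum 'I_n) u v.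
  by rewrite size_enum_ord !ltn_ord !nth_ord_enum; apply.
rewrite /adjacency_bit /encode nth_cat size_nseq ifN; last first.
  by rewrite -leqNgt; lia.
have -> : k * (n * n) + n.+1 + (u * n + v) - order x =
    (k * (n * n) + (u * n + v)).+1 by rewrite -/n; lia.
rewrite /= !nth_cat !size_adjacency_bits -!bitsE.
case: k lt_k => [|[|[|//]]] _.
- by rewrite mul0n add0n lt_uv.
- by rewrite mul1n ltnNge leq_addr /= addKn lt_uv.
- rewrite ifN; last by rewrite -leqNgt; lia.
  rewrite ifN; last by rewrite -leqNgt; lia.
  by congr (nth _ _ _); lia.
Qed.

(** Register 3 holds [n * n] and is added [k] times in place of a product. [y] names the register
    with the row offset, [x] the one with the column. *)
Definition adjacency_expr (k y x : nat) : expr :=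
  Mem (Add (iter k (Add (Reg 3)) (Add (Cst 1) (Reg 1))) (Add (Reg y) (Reg x))).

Lemma vertex_test_adjacency k u v :
  k < 3 -> u < 2 -> v < 3 ->
  vertex_test (encode x) n (adjacency_expr k (nth 0 [:: 7; 9] u)
      (nth 0 [:: 6; 8; 10] v))
    (fun a b c =>
       adjacency_bit k (nth 0 [:: a; b; c] u) (nth 0 [:: a; b; c] v)).
Proof.
move=> lt_k lt_u lt_v p pn a b c cn lt_a lt_b lt_c s M ag st.
rewrite /adjacency_expr; set e := Add _ _.
have -> : eval s (Mem e) = mem s (eval s e) by [].
rewrite st.
have -> : eval s e = k * (n * n) + n.+1 +
    (nth 0 [:: a; b; c] u * n + nth 0 [:: a; b; c] v).
  rewrite /e /=; congr (_ + _).
    elim: (k) => [|l IH] /=; first by rewrite ag.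
    by rewrite IH ag // mulSn addnA.
  clear e; case: u lt_u => [|[|//]] _.
    by case: v lt_v => [|[|[|//]]] _; rewrite !ag.
  by case: v lt_v => [|[|[|//]]] _; rewrite !ag.
(* Beyond the list the default 0 is also below [n], because [a < n]. *)
have lt_n m : nth 0 [:: a; b; c] m < n.
  by case: m => [|[|[|m]]] //=; rewrite nth_nil; apply: leq_ltn_trans lt_a.
rewrite size_encode ifT; first by rewrite /adjacency_bit; case: (nth _ _ _).
have lt_uv := offset_lt (lt_n u) (lt_n v).
have := leq_mul lt_k (leqnn (n * n)); rewrite mulSn; lia.
Qed.

End Encoding.

(** * From vertex tests to polynomial-time decision *)

Lemma vertex_test_conj w n e1 e2 P1 P2 :
  vertex_test w n e1 P1 -> vertex_test w n e2 P2 ->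
  vertex_test w n (conj_expr e1 e2) (fun a b c => P1 a b c && P2 a b c).
Proof.
move=> t1 t2 p pn a b c cn lt_a lt_b lt_c.
by apply: computes_conj; [apply: t1 | apply: t2].
Qed.

Lemma vertex_test_cst w n m :
  vertex_test w n (Cst m) (fun _ _ _ => m != 0).
Proof. by []. Qed.

Lemma vertex_test_neq_bc w n :
  vertex_test w n (neq_expr (Reg 8) (Reg 10)) (fun _ b c => b != c).
Proof. by move=> p pn a b c cn _ _ _ s M ag st; rewrite /= !ag //=; lia. Qed.

Lemma vertex_test_neq_ca w n :
  vertex_test w n (neq_expr (Reg 10) (Reg 6)) (fun a _ c => c != a).
Proof. by move=> p pn a b c cn _ _ _ s M ag st; rewrite /= !ag //=; lia. Qed.

(** For values that are bits, differing as numbers is the same as differing as truth values. *)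
Lemma vertex_test_neq w n e1 e2 (P1 P2 : nat -> nat -> nat -> bool) :
  vertex_test w n e1 P1 -> vertex_test w n e2 P2 ->
  (forall s M, stores w M s -> eval s e1 < 2 /\ eval s e2 < 2) ->
  vertex_test w n (neq_expr e1 e2) (fun a b c => P1 a b c != P2 a b c).
Proof.
move=> t1 t2 bool12 p pn a b c cn lt_a lt_b lt_c s M ag st.
rewrite -(t1 p pn a b c cn lt_a lt_b lt_c s M ag st).
rewrite -(t2 p pn a b c cn lt_a lt_b lt_c s M ag st).
by have [] := bool12 s M st; rewrite /=; lia.
Qed.

Lemma stores_bool w M s a : stores w M s -> mem s a < 2.
Proof. by move->; case: ifP => _; rewrite ltnS leq_b1. Qed.

Lemma linkedE n (S T F : nat -> nat -> nat -> bool)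
    (s t f : 'I_n -> 'I_n -> 'I_n -> bool) :
  (forall a b c : 'I_n, S a b c = s a b c) ->
  (forall a b c : 'I_n, T a b c = t a b c) ->
  (forall a b c : 'I_n, F a b c = f a b c) ->
  linked n S T F <->
  exists a b, [/\ center s a, connect (via t) a b & center f b].
Proof.
move=> Ss Tt Ff.
have sE : start_pred S =1 center s.
  by move=> a; apply: eq_existsb => b; apply: eq_existsb => c; exact: Ss.
have fE : stop_pred F =1 center f.
  by move=> a; apply: eq_existsb => b; apply: eq_existsb => c; exact: Ff.
have tE : connect (step_rel T) =2 connect (via t).
  by apply: eq_connect => a b; apply: eq_existsb => c; exact: Tt.
split=> [/existsP[a /existsP[b /and3P[]]]|[a [b []]]].
  by rewrite sE fE tE => sa ab fb; exists a, b.
move=> sa ab fb; apply/existsP; exists a; apply/existsP; exists b.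
by rewrite sE fE tE sa ab fb.
Qed.

(** Leaves only three tests to be supplied for each case, together with a proof that [linked]
    expresses the answer. *)
Lemma poly_time_link (Pi : graph_property) (yes : instance Pi -> Prop)
    (start step stop : expr) (negated : bool)
    (S T F : instance Pi -> nat -> nat -> nat -> bool) :
  (forall x : instance Pi, 0 < order x) ->
  (forall x, vertex_test (encode x) (order x) start (S x)) ->
  (forall x, vertex_test (encode x) (order x) step (T x)) ->
  (forall x, vertex_test (encode x) (order x) stop (F x)) ->
  (forall x, negated (+) linked (order x) (S x) (T x) (F x) <-> yes x) ->
  poly_time_solvable (@encode Pi) yes.
Proof.
move=> n_gt0 tS tT tF correct.
exists (link_program start step stop negated), (link_time start step stop) => x.
have [|t [s [ex le_t acc]]] :=
  link_program_correct negated _ (@nth_encode_unary _ x) (tS x) (tT x) (tF x).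
  (* The input has [n + 1 + 3n^2] bits, which is at least [n + 2] once there is a vertex. *)
  by rewrite size_encode; have := n_gt0 x; nia.
by exists t, s; split=> //; rewrite acc; exact: correct.
Qed.

(** The same program works: the encoding depends on the graph and the two edge sets, and only the
    feasibility proofs have to be transported. *)
Lemma poly_time_ext (Pi Pi' : graph_property) (r : rule) :
  (forall T V E, Pi T V E = Pi' T V E) ->
  poly_time_solvable (@encode Pi) (@edge_reconfiguration Pi r) ->
  poly_time_solvable (@encode Pi') (@edge_reconfiguration Pi' r).
Proof.
move=> eqPi [c [p solves]]; exists c, p => x.
have feasE F : feasible Pi (graph x) F = feasible Pi' (graph x) F.
  by rewrite /feasible eqPi.
have sF := source_feasible x; have tF := target_feasible x.
rewrite -feasE in sF; rewrite -feasE in tF.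
have [t [s [ex le_t acc]]] := solves (Instance sF tF).
exists t, s; split=> //; rewrite acc /edge_reconfiguration /=.
split=> -[q [fq pq lq]]; exists q; split=> //; first by rewrite -(eq_all feasE).
by rewrite (eq_all feasE).
Qed.

(** * The decision programs, case by case *)

Lemma reconfigurable_rigid (r : rule) (T : finType) (G : sgraph T) i j X Y :
  1 < i -> 1 < j -> feasible (biclique i j) G X ->
  reconfigurable (biclique i j) r G X Y <-> X = Y.
Proof.
move=> i_gt1 j_gt1 fX; split=> [|<-]; last exact: reconfigurable_refl.
case=> -[|Z p] [/=]; first by [].
move=> /and3P[_ /andP[_ bZ] _] /andP[aXZ _]; case/andP: fX => _ bX.
by rewrite (negPf (biclique_rigid r i_gt1 j_gt1 bX bZ)) in aXZ.
Qed.

Lemma instance_order_gt0 i j (x : instance (biclique i j)) :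
  0 < i -> 0 < order x.
Proof.
move=> i_gt0; case/andP: (source_feasible x) => _ /(biclique_order_gt0 i_gt0).
by rewrite card_ord.
Qed.

(** The marking program is used to compare source and target: every vertex is a start, there are no
    moves, and a vertex is a stop if it lies on a pair contained in exactly one of the two. Finding
    one means no. *)
Lemma poly_time_rigid (i j : nat) (r : rule) : 1 < i -> 1 < j ->
  poly_time_solvable (@encode (biclique i j))
                     (@edge_reconfiguration (biclique i j) r).
Proof.
move=> i_gt1 j_gt1.
apply: (poly_time_link (negated := true)
    (start := Cst 1) (step := Cst 0)
    (stop := neq_expr (adjacency_expr 1 7 8) (adjacency_expr 2 7 8))
    (S := fun _ _ _ _ => true) (T := fun _ _ _ _ => false)
    (F := fun x a b _ => adjacency_bit x 1 a b != adjacency_bit x 2 a b)).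
- by move=> x; apply: instance_order_gt0; exact: ltnW.
- by move=> x; exact: vertex_test_cst.
- by move=> x; exact: (@vertex_test_cst _ _ 0).
- move=> x; apply: vertex_test_neq.
  + exact: (@vertex_test_adjacency _ x 1 0 1).
  + exact: (@vertex_test_adjacency _ x 2 0 1).
  + by move=> s M st; split; exact: stores_bool st.
move=> x; rewrite /edge_reconfiguration.
apply: iff_trans (iff_sym (reconfigurable_rigid r (target x) i_gt1 j_gt1
  (source_feasible x))).
set l := linked _ _ _ _.
have lE : l <-> exists a b : 'I_(order x),
    [/\ center (fun _ _ _ => true) a, connect (via (fun _ _ _ => false)) a b
      & center (fun a b _ : 'I_(order x) =>
                  ([set a; b] \in source x) != ([set a; b] \in target x)) b].
  by apply: linkedE => // a b c; rewrite !adjacency_bitE.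
split=> [/negP nl|st].
  (* Both solutions consist of edges of the graph, which are pairs, so comparing them on pairs
     suffices. *)
  have eq_mem e : e \in edges (graph x) -> (e \in source x) = (e \in target x).
    move=> /edges_card2/eqP/cards2P[a [b [_ ->]]].
    apply/eqP/negPn/negP=> neq_ab; apply: nl; apply/lE; exists a, a.
    split; rewrite ?connect0 //; apply/existsP; exists b;
      by apply/existsP; exists b.
  have [/andP[/subsetP sG _] /andP[/subsetP tG _]] :=
    (source_feasible x, target_feasible x).
  apply/setP=> e; apply/idP/idP => eX; first by rewrite -eq_mem ?sG.
  by rewrite eq_mem ?tG.
apply/negP => /lE[a [b [_ _ /existsP[c /existsP[d]]]]].
by rewrite st eqxx.
Qed.

Definition forks_expr (k : nat) : expr :=
  conj_expr (adjacency_expr k 7 8)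
    (conj_expr (adjacency_expr k 7 10) (neq_expr (Reg 8) (Reg 10))).

Definition forks_bits (Pi : graph_property) (x : instance Pi) (k a b c : nat) :=
  [&& adjacency_bit x k a b, adjacency_bit x k a c & b != c].

Lemma vertex_test_forks (Pi : graph_property) (x : instance Pi) k : k < 3 ->
  vertex_test (encode x) (order x) (forks_expr k) (forks_bits x k).
Proof.
move=> lt_k; apply: vertex_test_conj.
  exact: (@vertex_test_adjacency _ x k 0 1).
apply: vertex_test_conj; last exact: vertex_test_neq_bc.
exact: (@vertex_test_adjacency _ x k 0 2).
Qed.

Lemma forks_bitsE (Pi : graph_property) (x : instance Pi) k
    (a b c : 'I_(order x)) :
  k < 3 -> forks_bits x k a b c = forks (layer x k) a b c.
Proof. by move=> lt_k; rewrite /forks_bits !adjacency_bitE. Qed.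

Lemma poly_time_rigid_center (k : nat) (r : rule) : 2 < k ->
  poly_time_solvable (@encode (biclique 1 k))
                     (@edge_reconfiguration (biclique 1 k) r).
Proof.
move=> k_gt2; have k_gt0 : 0 < k by apply: leq_trans k_gt2.
apply: (poly_time_link (negated := false)
    (start := forks_expr 1) (step := Cst 0) (stop := forks_expr 2)
    (S := fun x => forks_bits x 1) (T := fun _ _ _ _ => false)
    (F := fun x => forks_bits x 2)).
- by move=> x; exact: instance_order_gt0.
- by move=> x; exact: vertex_test_forks.
- by move=> x; exact: (@vertex_test_cst _ _ 0).
- by move=> x; exact: vertex_test_forks.
move=> x; rewrite /edge_reconfiguration.
apply: iff_trans (iff_sym (reconfigurable_rigid_center r k_gt0 k_gt2
  (source_feasible x) (target_feasible x))).
by apply: linkedE => // a b c; exact: forks_bitsE.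
Qed.

Lemma poly_time_path2 (r : rule) :
  poly_time_solvable (@encode (biclique 1 2))
                     (@edge_reconfiguration (biclique 1 2) r).
Proof.
(* The third edge of the triangle is tested under token sliding; under token jumping the test is
   constantly true. *)
pose chord : expr := if r is TS then adjacency_expr 0 7 10 else Cst 1.
apply: (poly_time_link (negated := false)
    (start := forks_expr 1)
    (step := conj_expr (adjacency_expr 0 7 8) (conj_expr (adjacency_expr 0 9 10)
               (conj_expr (neq_expr (Reg 10) (Reg 6)) chord)))
    (stop := forks_expr 2) (S := fun x => forks_bits x 1)
    (T := fun x a b c =>
            [&& adjacency_bit x 0 a b, adjacency_bit x 0 b c, c != a
              & if r is TS then adjacency_bit x 0 a c else true])
    (F := fun x => forks_bits x 2)).
- by move=> x; exact: instance_order_gt0.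
- by move=> x; exact: vertex_test_forks.
- move=> x; apply: vertex_test_conj.
    exact: (@vertex_test_adjacency _ x 0 0 1).
  apply: vertex_test_conj; first exact: (@vertex_test_adjacency _ x 0 1 2).
  apply: vertex_test_conj; first exact: vertex_test_neq_ca.
  rewrite /chord; case: (r); first exact: vertex_test_cst.
  exact: (@vertex_test_adjacency _ x 0 0 2).
- by move=> x; exact: vertex_test_forks.
move=> x; rewrite /edge_reconfiguration.
apply: iff_trans (iff_sym (reconfigurable_path2 (k := 2) r isT erefl
  (source_feasible x) (target_feasible x))).
apply: linkedE => a b c; [exact: forks_bitsE | | exact: forks_bitsE].
by rewrite /path2 !adjacency_bitE.
Qed.

(** Under token jumping nothing is ever marked, and the negated program always accepts. *)
Lemma poly_time_edge (r : rule) :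
  poly_time_solvable (@encode (biclique 1 1))
                     (@edge_reconfiguration (biclique 1 1) r).
Proof.
case: r.
  apply: (poly_time_link (negated := true)
    (start := Cst 0) (step := Cst 0) (stop := Cst 0)
    (S := fun _ _ _ _ => false) (T := fun _ _ _ _ => false)
    (F := fun _ _ _ _ => false)).
  - by move=> x; exact: instance_order_gt0.
  - by move=> x; exact: (@vertex_test_cst _ _ 0).
  - by move=> x; exact: (@vertex_test_cst _ _ 0).
  - by move=> x; exact: (@vertex_test_cst _ _ 0).
  move=> x; split=> [_|_].
    exact: (reconfigurable_edge TJ _ _ (source_feasible x) (target_feasible x)).
  apply/negP => /existsP[a /existsP[b /and3P[/existsP[c /existsP[]]]]] //.
apply: (poly_time_link (negated := false)
    (start := adjacency_expr 1 7 8) (step := adjacency_expr 0 7 8)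
    (stop := adjacency_expr 2 7 8)
    (S := fun x a b _ => adjacency_bit x 1 a b)
    (T := fun x a b _ => adjacency_bit x 0 a b)
    (F := fun x a b _ => adjacency_bit x 2 a b)).
- by move=> x; exact: instance_order_gt0.
- by move=> x; exact: (@vertex_test_adjacency _ x 1 0 1).
- by move=> x; exact: (@vertex_test_adjacency _ x 0 0 1).
- by move=> x; exact: (@vertex_test_adjacency _ x 2 0 1).
move=> x; rewrite /edge_reconfiguration.
apply: iff_trans (iff_sym (reconfigurable_edge (k := 1) TS isT erefl
  (source_feasible x) (target_feasible x))).
by apply: linkedE => a b c; rewrite adjacency_bitE.
Qed.

Lemma poly_time_star (k : nat) (r : rule) : 0 < k ->
  poly_time_solvable (@encode (biclique 1 k))
                     (@edge_reconfiguration (biclique 1 k) r).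
Proof.
case: k => [|[|[|k]]] // _.
- exact: poly_time_edge.
- exact: poly_time_path2.
- exact: poly_time_rigid_center.
Qed.

Theorem theorem5 (i j : nat) (r : rule) :
  0 < i -> 0 < j ->
  poly_time_solvable (@encode (biclique i j))
                     (@edge_reconfiguration (biclique i j) r).
Proof.
case: i => [|[|i]] // _; first exact: poly_time_star.
case: j => [|[|j]] // _; last exact: poly_time_rigid.
(* The one-element side is the second one here; exchanging the sides gives a star. *)
apply: (@poly_time_ext (biclique 1 i.+2)) => [T V E|].
  exact: biclique_sym.
exact: poly_time_star.
Qed.
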